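(* For all integers $n\geq 0$, $$a_{1^{-1}2^{2}4^{-2}5^{1}}(4n)>0,\qquad a_{1^{-1}2^{2}4^{-2}5^{1}}(2n+1)>0,\qquad a_{1^{-1}2^{2}4^{-2}5^{1}}(4n+2)=0.$$
   Context: For $|q|<1$ (or as formal power series in $q$) let $f_j:=(q^j;q^j)_\infty=\prod_{k\ge 1}(1-q^{jk})$ for each positive integer $j$. The integers $a_{1^{-1}2^{2}4^{-2}5^{1}}(n)$, $n\ge 0$, are defined by $\sum_{n=0}^\infty a_{1^{-1}2^{2}4^{-2}5^{1}}(n)q^n=\dfrac{f_2^2f_5}{f_1f_4^2}$. *)

(* Defs.v *)
From HB Require Import structures.
From mathcomp Require Import all_boot all_order all_algebra.
From mathcomp Require Import boolp.

Set Implicit Arguments.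
Unset Strict Implicit.
Unset Printing Implicit Defensive.

Import Order.TTheory GRing.Theory Num.Theory.
Local Open Scope ring_scope.

(* The ring R[[q]] of formal power series; [f n] is the coefficient of q^n. *)
Record fps (R : Type) := Fps { fps_coef :> nat -> R }.

HB.instance Definition _ (R : Type) := gen_eqMixin (fps R).
HB.instance Definition _ (R : Type) := gen_choiceMixin (fps R).

Lemma fpsP (R : Type) (f g : fps R) : (forall n, f n = g n) <-> f = g.
Proof.
split=> [|->//]; case: f g => [f] [g] /= fg.
by congr Fps; apply/funext.
Qed.

Definition fps_zero (R : comNzRingType) : fps R := Fps (fun=> 0).
Definition fps_opp (R : comNzRingType) (f : fps R) : fps R :=
  Fps (fun n => - f n).
Definition fps_add (R : comNzRingType) (f g : fps R) : fps R :=
  Fps (fun n => f n + g n).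
Definition fps_one (R : comNzRingType) : fps R := Fps (fun n => (n == 0%N)%:R).
Definition fps_mul (R : comNzRingType) (f g : fps R) : fps R :=
  Fps (fun n => \sum_(i < n.+1) f i * g (n - i)%N).

Fact fps_addA (R : comNzRingType) : associative (@fps_add R).
Proof. by move=> f g h; apply/fpsP => n /=; rewrite addrA. Qed.
Fact fps_addC (R : comNzRingType) : commutative (@fps_add R).
Proof. by move=> f g; apply/fpsP => n /=; rewrite addrC. Qed.
Fact fps_add0 (R : comNzRingType) : left_id (fps_zero R) (@fps_add R).
Proof. by move=> f; apply/fpsP => n /=; rewrite add0r. Qed.
Fact fps_addN (R : comNzRingType) :
  left_inverse (fps_zero R) (@fps_opp R) (@fps_add R).
Proof. by move=> f; apply/fpsP => n /=; rewrite addNr. Qed.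

HB.instance Definition _ (R : comNzRingType) :=
  GRing.isZmodule.Build (fps R)
    (@fps_addA R) (@fps_addC R) (@fps_add0 R) (@fps_addN R).

Lemma fps_mul_poly (R : comNzRingType) (f g : fps R) (p r : {poly R}) n :
  (forall i, (i <= n)%N -> f i = p`_i) ->
  (forall i, (i <= n)%N -> g i = r`_i) ->
  fps_mul f g n = (p * r)`_n.
Proof.
move=> fp gr; rewrite coefM; apply: eq_bigr => i _.
by rewrite fp ?gr ?leq_subr // -ltnS ltn_ord.
Qed.

Lemma fps_truncE (R : comNzRingType) (f : fps R) (n i : nat) :
  (i <= n)%N -> f i = (\poly_(k < n.+1) f k)`_i.
Proof. by move=> le_in; rewrite coef_poly ltnS le_in. Qed.

Fact fps_mulA (R : comNzRingType) : associative (@fps_mul R).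
Proof.
move=> f g h; apply/fpsP => n.
have T u i := @fps_truncE R u n i.
have M (u v : fps R) i (le_in : (i <= n)%N) : fps_mul u v i =
    ((\poly_(k < n.+1) u k) * (\poly_(k < n.+1) v k))`_i.
  by apply: fps_mul_poly => j le_ji; apply: T (leq_trans le_ji le_in).
rewrite (fps_mul_poly (T f) (M g h)) (fps_mul_poly (M f g) (T h)).
by rewrite mulrA.
Qed.

Fact fps_mulC (R : comNzRingType) : commutative (@fps_mul R).
Proof.
move=> f g; apply/fpsP => n.
rewrite (fps_mul_poly (@fps_truncE R f n) (@fps_truncE R g n)).
by rewrite (fps_mul_poly (@fps_truncE R g n) (@fps_truncE R f n)) mulrC.
Qed.

Fact fps_mul1 (R : comNzRingType) : left_id (fps_one R) (@fps_mul R).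
Proof.
move=> f; apply/fpsP => n /=; rewrite big_ord_recl /= mul1r subn0.
by rewrite big1 ?addr0 // => i _; rewrite mul0r.
Qed.

Fact fps_mulDl (R : comNzRingType) : left_distributive (@fps_mul R) +%R.
Proof.
move=> f g h; apply/fpsP => n /=; rewrite -big_split /=.
by apply: eq_bigr => i _; rewrite mulrDl.
Qed.

Fact fps_one_neq0 (R : comNzRingType) : fps_one R != 0.
Proof.
by apply/eqP => /fpsP /(_ 0%N) /= /eqP; rewrite oner_eq0.
Qed.

HB.instance Definition _ (R : comNzRingType) :=
  GRing.Zmodule_isComNzRing.Build (fps R)
    (@fps_mulA R) (@fps_mulC R) (@fps_mul1 R) (@fps_mulDl R) (@fps_one_neq0 R).

(* A series is invertible iff its constant term is; the first [n] coefficients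
   of the inverse g are obtained by solving f * g = 1 recursively. *)
Definition fps_unit (R : comUnitRingType) : pred (fps R) :=
  fun f => f 0%N \is a GRing.unit.

Fixpoint fps_inv_seq (R : comUnitRingType) (f : fps R) (n : nat) : seq R :=
  if n is m.+1 then
    let s := fps_inv_seq f m in
    rcons s ((f 0%N)^-1 * ((m == 0%N)%:R - \sum_(i < m) f (m - i)%N * s`_i))
  else [::].

Definition fps_inv (R : comUnitRingType) (f : fps R) : fps R :=
  if fps_unit f then Fps (fun n => (fps_inv_seq f n.+1)`_n) else f.

Lemma size_fps_inv_seq (R : comUnitRingType) (f : fps R) (n : nat) :
  size (fps_inv_seq f n) = n.
Proof. by elim: n => //= n IHn; rewrite size_rcons IHn. Qed.

Lemma nth_fps_inv_seq (R : comUnitRingType) (f : fps R) (n i : nat) :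
  (i < n)%N -> (fps_inv_seq f n)`_i = (fps_inv_seq f i.+1)`_i.
Proof.
elim: n => // n IHn; rewrite ltnS leq_eqVlt => /predU1P[-> // | lt_in].
by rewrite [in LHS]/= nth_rcons size_fps_inv_seq lt_in IHn.
Qed.

Fact fps_mulV (R : comUnitRingType) :
  {in @fps_unit R, left_inverse 1 (@fps_inv R) *%R}.
Proof.
move=> f fU; rewrite /fps_inv [fps_unit f]fU; apply/fpsP => n.
rewrite [LHS]/= big_ord_recr /= subnn nth_rcons size_fps_inv_seq ltnn eqxx.
rewrite [_ * f 0%N]mulrC mulrA divrr // mul1r addrC.
rewrite -[RHS](subrK (\sum_(i < n) f (n - i)%N * (fps_inv_seq f n)`_i)).
by congr (_ + _); apply: eq_bigr => i _;
  rewrite mulrC (nth_fps_inv_seq f (ltn_ord i)).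
Qed.

Fact fps_unitPl (R : comUnitRingType) (f g : fps R) :
  g * f = 1 -> fps_unit f.
Proof.
move=> /fpsP /(_ 0%N); rewrite [LHS]/= big_ord1 /= => gf1.
by apply/unitrPr; exists (g 0%N); rewrite mulrC.
Qed.

Fact fps_inv_out (R : comUnitRingType) :
  {in [predC @fps_unit R], @fps_inv R =1 id}.
Proof. by move=> f /negbTE nUf; rewrite /fps_inv [fps_unit f]nUf. Qed.

HB.instance Definition _ (R : comUnitRingType) :=
  GRing.ComNzRing_hasMulInverse.Build (fps R)
    (@fps_mulV R) (@fps_unitPl R) (@fps_inv_out R).

(* f_j = (q^j; q^j)_oo. For j > 0 the coefficient of q^n in the partial
   products prod_(1 <= k <= m) (1 - q^(jk)) no longer changes once m >= n
   (lemma [qprodE]), so it is read off at m = n. *)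
Definition qpartial (j m : nat) : {poly int} :=
  \prod_(1 <= k < m.+1) (1 - 'X^(j * k)).

Definition qprod (j : nat) : fps int := Fps (fun n => (qpartial j n)`_n).

Lemma qprodE (j m n : nat) :
  (0 < j)%N -> (n <= m)%N -> (qpartial j m)`_n = qprod j n.
Proof.
move=> j_gt0; elim: m => [|m IHm]; first by rewrite leqn0 => /eqP->.
rewrite leq_eqVlt => /predU1P[-> // | lt_nm].
rewrite /qpartial big_nat_recr //= mulrBr mulr1 coefB coefMXn.
by rewrite (leq_trans lt_nm (leq_pmull _ j_gt0)) subr0 IHm.
Qed.

Lemma qprod_unit (j : nat) : qprod j \is a GRing.unit.
Proof. by rewrite unfold_in /= /fps_unit /= /qpartial big_geq // coef1. Qed.

Definition quotient_series : fps int :=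
  (qprod 2 ^+ 2 * qprod 5) / (qprod 1 * qprod 4 ^+ 2).

Definition a (n : nat) : int := quotient_series n.

(* Main.v *)
(** Multiplying the factors [1 - q^k] ([k] odd, [5] not dividing [k]) of
    [f_1 / f_5] by [1 + q^k] makes them even in [q] and leaves
    [prod (1 + q^k)] over these [k] as the only factor that is not.  By the
    Jacobi triple product (obtained as the limit of the q-binomial theorem)
    [f_10^2] times that factor is [f(q, q^9) f(q^3, q^7)], and splitting the
    double theta series according to the parity of [i + j] gives
    [f(q^4, q^16) f(q^8, q^12) + q f(q^6, q^14) f(q^2, q^18)].  Back to products,
      [f_2^2 f_5 / (f_1 f_4^2) = U + q V],
    [U = prod_(4 | k) (1 + q^k) / (1 - q^k)] and
    [V = prod_(k = 2 mod 4) (1 + q^k) / prod_(4 | k) (1 - q^k)], where [k] is never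
    divisible by [5].  [U] is a series in [q^4], [V] a series in [q^2];
    they are coefficientwise at least [1 / (1 - q^4)] and
    [(1 + q^2) / (1 - q^4) = 1 / (1 - q^2)]. *)

Require Import Defs.
From mathcomp Require Import all_boot all_order all_algebra.
From mathcomp Require Import zify ring.

Set Implicit Arguments.
Unset Strict Implicit.
Unset Printing Implicit Defensive.

Import Order.TTheory GRing.Theory Num.Theory.
Local Open Scope ring_scope.

(** * Coefficients of power series and congruence modulo [q^N] *)

Lemma coef_fpsD (f g : fps int) n : (f + g) n = f n + g n.
Proof. by []. Qed.

Lemma coef_fpsN (f : fps int) n : (- f) n = - f n.
Proof. by []. Qed.

Lemma coef_fps1 n : (1 : fps int) n = (n == 0%N)%:R.
Proof. by []. Qed.

Lemma coef_fpsM (f g : fps int) n : (f * g) n = \sum_(i < n.+1) f i * g (n - i)%N.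
Proof. by []. Qed.

Lemma coef_fps_sum (I : Type) (r : seq I) (F : I -> fps int) n :
  (\sum_(i <- r) F i) n = \sum_(i <- r) F i n.
Proof. by elim/big_rec2: _ => // i y1 y2 _ <-. Qed.

Definition q : fps int := Fps (fun n => (n == 1%N)%:R).

Lemma coef_qMS (f : fps int) n : (q * f) n.+1 = f n.
Proof.
rewrite coef_fpsM !big_ord_recl /= mul0r add0r mul1r subn1 /=.
by rewrite big1 ?addr0 // => i _; rewrite mul0r.
Qed.

Lemma coef_qM0 (f : fps int) : (q * f) 0%N = 0.
Proof. by rewrite coef_fpsM big_ord1 mul0r. Qed.

Lemma coef_qXM k (f : fps int) n :
  (q ^+ k * f) n = if (n < k)%N then 0 else f (n - k)%N.
Proof.
elim: k n => [|k IHk] n; first by rewrite expr0 mul1r subn0.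
rewrite exprS -mulrA; case: n => [|n]; first by rewrite coef_qM0.
by rewrite coef_qMS IHk.
Qed.

Lemma coef_qX k n : (q ^+ k) n = (n == k)%:R.
Proof. by rewrite -[q ^+ k]mulr1 coef_qXM coef_fps1; case: ltngtP => // h; lia. Qed.

Lemma mulqXI k : injective (fun f : fps int => q ^+ k * f).
Proof.
move=> f g /fpsP fg; apply/fpsP => n; have := fg (n + k)%N.
by rewrite !coef_qXM ltnNge leq_addl addnK.
Qed.

Definition eqmod N (f g : fps int) := forall i, (i < N)%N -> f i = g i.

Lemma eqmod_refl N f : eqmod N f f.
Proof. by []. Qed.

Lemma eqmod_sym N f g : eqmod N f g -> eqmod N g f.
Proof. by move=> fg i /fg. Qed.

Lemma eqmod_trans N f g h : eqmod N f g -> eqmod N g h -> eqmod N f h.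
Proof. by move=> fg gh i iN; rewrite fg ?gh. Qed.

Lemma eqmod_le M N f g : (M <= N)%N -> eqmod N f g -> eqmod M f g.
Proof. by move=> MN fg i iM; apply/fg/(leq_trans iM). Qed.

Lemma eqmodM N f f' g g' :
  eqmod N f f' -> eqmod N g g' -> eqmod N (f * g) (f' * g').
Proof.
move=> ff gg n nN; rewrite !coef_fpsM; apply: eq_bigr => i _.
by rewrite ff ?gg //; [lia | case: i => i /=; lia].
Qed.

Lemma eqmod_sum N (I : Type) (r : seq I) (F G : I -> fps int) :
  (forall i, eqmod N (F i) (G i)) ->
  eqmod N (\sum_(i <- r) F i) (\sum_(i <- r) G i).
Proof.
by move=> FG n nN; rewrite !coef_fps_sum; apply: eq_bigr => i _; apply: FG.
Qed.

Lemma eqmod_prod1 N (I : eqType) (r : seq I) (F : I -> fps int) :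
  (forall i, i \in r -> eqmod N (F i) 1) -> eqmod N (\prod_(i <- r) F i) 1.
Proof.
move=> F1; rewrite big_seq; apply: (big_ind (eqmod N ^~ 1)) => //.
by move=> f g f1 g1; have := eqmodM f1 g1; rewrite mulr1.
Qed.

Lemma eqmod_all_eq f g : (forall N, eqmod N f g) -> f = g.
Proof. by move=> fg; apply/fpsP => n; apply: (fg n.+1). Qed.

Lemma eqmod_qX N k f g : eqmod N f g -> eqmod (k + N) (q ^+ k * f) (q ^+ k * g).
Proof.
move=> fg n nN; rewrite !coef_qXM; case: ifP => // nk; apply: fg; lia.
Qed.

(** * Infinite products of power series *)

(* Makes the infinite product of the [u k], [k > 0], converge. *)
Definition qadic (u : nat -> fps int) := forall k, (0 < k)%N -> eqmod k (u k) 1.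

Definition iprod (u : nat -> fps int) : fps int :=
  Fps (fun n => (\prod_(1 <= k < n.+1) u k) n).

(** The factors with index beyond [n] are 1 up to and including [q^n], so the coefficient of [q^n]
    is final once [n] factors are multiplied. *)
Lemma iprod_eqmod u m : qadic u -> eqmod m.+1 (\prod_(1 <= k < m.+1) u k) (iprod u).
Proof.
move=> u1 n; rewrite ltnS => nm /=.
rewrite (big_cat_nat (n := n.+1)) //=.
rewrite -[RHS]/(_ n) -[in RHS](mulr1 (\prod_(_ <= _ < _) _)).
apply: (@eqmodM n.+1) => //; apply: eqmod_prod1 => i.
rewrite mem_index_iota => /andP[ni _].
by apply: eqmod_le (u1 i _) => //; lia.
Qed.

Lemma eq_iprod u v : (forall k, (0 < k)%N -> u k = v k) -> iprod u = iprod v.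
Proof.
move=> uv; apply/fpsP => n /=; congr (fps_coef _ n).
by rewrite !big_nat; apply: eq_bigr => k /andP[k0 _]; apply: uv.
Qed.

Lemma iprodM u v : qadic u -> qadic v ->
  iprod (fun k => u k * v k) = iprod u * iprod v.
Proof.
move=> u1 v1; apply/fpsP => n.
rewrite /= big_split -[RHS]/((iprod u * iprod v) n).
by apply: (eqmodM (iprod_eqmod u1) (iprod_eqmod v1)).
Qed.

Definition sprod (S : pred nat) u := iprod (fun k => if S k then u k else 1).

Lemma qadic_if (S : pred nat) u : qadic u -> qadic (fun k => if S k then u k else 1).
Proof. by move=> u1 k k0; case: ifP => // _; apply: u1. Qed.

Lemma sprod_eqmod (S : pred nat) u m : qadic u ->
  eqmod m.+1 (\prod_(1 <= k < m.+1 | S k) u k) (sprod S u).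
Proof. by move=> u1; rewrite big_mkcond; apply/iprod_eqmod/qadic_if. Qed.

Lemma eq_sprod (S T : pred nat) u v :
  S =1 T -> (forall k, u k = v k) -> sprod S u = sprod T v.
Proof. by move=> ST uv; apply: eq_iprod => k _; rewrite ST uv. Qed.

Lemma sprodM S u v : qadic u -> qadic v ->
  sprod S (fun k => u k * v k) = sprod S u * sprod S v.
Proof.
move=> u1 v1; rewrite -iprodM; try exact: qadic_if.
by apply: eq_iprod => k _; case: ifP; rewrite ?mulr1.
Qed.

(** Adding booleans as numbers expresses a disjoint union in one equation, which [lia] can check for
    sets given by residues. *)
Lemma sprodU (S T U : pred nat) u : qadic u ->
  (forall k, (0 < k)%N -> (U k = S k + T k :> nat)%N) ->
  sprod U u = sprod S u * sprod T u.
Proof.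
move=> u1 UST; rewrite -iprodM; try exact: qadic_if.
apply: eq_iprod => k /UST; case: (U k); case: (S k); case: (T k) => // _;
  by rewrite ?mulr1 ?mul1r.
Qed.

Lemma sprodU4 (S1 S2 S3 S4 U : pred nat) u : qadic u ->
  (forall k, (0 < k)%N -> (U k = S1 k + S2 k + (S3 k + S4 k) :> nat)%N) ->
  sprod U u = (sprod S1 u * sprod S2 u) * (sprod S3 u * sprod S4 u).
Proof.
move=> u1 US.
rewrite -(@sprodU S1 S2 (predU S1 S2)) //; last first.
  by move=> k /US /=; case: (U k); case: (S1 k); case: (S2 k); lia.
rewrite -(@sprodU S3 S4 (predU S3 S4)) //; last first.
  by move=> k /US /=; case: (U k); case: (S3 k); case: (S4 k); lia.
apply: sprodU => // k /US /=.
by case: (U k); case: (S1 k); case: (S2 k); case: (S3 k); case: (S4 k).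
Qed.

Lemma sprod1 i u : (0 < i)%N -> qadic u -> sprod (pred1 i) u = u i.
Proof.
move=> i0 u1; apply: eqmod_all_eq => N; apply: eqmod_sym.
apply: (@eqmod_le _ (N + i).+1); first lia.
apply: eqmod_trans (sprod_eqmod _ u1).
by rewrite /= big_nat1_eq ifT //; lia.
Qed.

(** Each block [m * N < k <= m * N.+1] meets the residue class only in [a + m * N]. The case [a = m]
    covers the positive multiples of [m]. *)
Lemma prod_residue (u : nat -> fps int) a m N : (0 < a <= m)%N ->
  \prod_(0 <= k < N) u (a + m * k)%N =
  \prod_(1 <= k < (m * N).+1 | k == a %[mod m]) u k.
Proof.
move=> am; elim: N => [|N IHN]; first by rewrite muln0 !big_geq.
rewrite big_nat_recr //= IHN.
rewrite (big_cat_nat (n := (m * N).+1) (p := (m * N.+1).+1)) //=; last by nia.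
congr (_ * _); rewrite -big_filter.
rewrite (_ : [seq _ <- _ | _] = [:: (a + m * N)%N]) ?big_seq1 //.
apply: perm_small_eq => //; apply: uniq_perm; rewrite ?filter_uniq ?iota_uniq //.
move=> k; rewrite mem_filter mem_index_iota inE.
apply/idP/idP => [/and3P[/eqP ka k1 k2]|/eqP->]; last first.
  by rewrite mulnC addnC modnMDl eqxx /=; nia.
(* The position [r] in the block runs from 1 to [m], so residue 0 shows up as [r = m] or [a = m] and
   is treated apart. *)
pose r := (k - m * N)%N; have kE : k = (N * m + r)%N by rewrite /r; lia.
have {k1 k2} rm : (0 < r <= m)%N by rewrite /r; lia.
suff : r = a by rewrite kE mulnC addnC => ->.
move: ka; rewrite kE modnMDl.
have [->|nr] := eqVneq r m; have [->|na] := eqVneq a m => //.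
- by rewrite modnn modn_small; lia.
- by rewrite modnn modn_small; lia.
- by rewrite !modn_small; lia.
Qed.

(** * The factors [1 - q^k], [1 + q^k] and [1 / (1 - q^k)] *)

Definition qminus k := 1 - q ^+ k.
Definition qplus k := 1 + q ^+ k.
Definition qgeom k : fps int := Fps (fun n => (k %| n)%N%:R).

Lemma qadic_qminus : qadic qminus.
Proof.
move=> k k0 i ik; rewrite coef_fpsD coef_fpsN coef_qX.
by rewrite (ltn_eqF ik) subr0.
Qed.

Lemma qadic_qplus : qadic qplus.
Proof. by move=> k k0 i ik; rewrite coef_fpsD coef_qX (ltn_eqF ik) addr0. Qed.

Lemma qadic_qgeom : qadic qgeom.
Proof.
move=> k k0 [|i] ik; first by rewrite /= dvdn0.
by rewrite /= gtnNdvd.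
Qed.

Lemma qminus_qgeom k : (0 < k)%N -> qminus k * qgeom k = 1.
Proof.
move=> k0; apply/fpsP => n.
rewrite mulrBl mul1r coef_fpsD coef_fpsN coef_qXM coef_fps1 /=.
case: ltnP => nk.
  case: n nk => [|n] nk; first by rewrite dvdn0 subr0.
  by rewrite gtnNdvd // subr0.
by rewrite dvdn_subl // subrr; case: n nk => //; lia.
Qed.

Lemma sprod_qminus_qgeom S : sprod S qminus * sprod S qgeom = 1.
Proof.
rewrite -sprodM; [|exact: qadic_qminus|exact: qadic_qgeom].
rewrite /sprod (@eq_iprod _ (fun=> 1)); last first.
  by move=> k k0; rewrite qminus_qgeom //; case: ifP.
by apply/fpsP => n; rewrite /= big1.
Qed.

Lemma qminus_qplus k : qminus k * qplus k = qminus (2 * k).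
Proof. by rewrite /qminus /qplus mulnC exprM; ring. Qed.

Lemma sprod_qminus_qplus S :
  sprod S qminus * sprod S qplus =
  sprod (fun k => ~~ odd k && S k./2) qminus.
Proof.
rewrite -sprodM; [|exact: qadic_qminus|exact: qadic_qplus].
apply: eqmod_all_eq => N; apply: (@eqmod_le _ N.+1) => //.
have ok : qadic (fun k => qminus k * qplus k).
  move=> k k0; rewrite qminus_qplus; apply: eqmod_le (qadic_qminus _); lia.
apply: eqmod_trans (eqmod_sym (sprod_eqmod _ ok)) _.
apply: eqmod_trans; last first.
  apply: (@eqmod_le _ (2 * N).+1); [lia|exact: sprod_eqmod qadic_qminus].
rewrite big_mkcond /= (big_addn 0 N.+1 1) subn1 /=.
(* Indexed by the doubled exponent, the factors form the progression [2 + 2 * k], to which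
   [prod_residue] applies with [a = m = 2]. *)
pose v k := if S k./2 then qminus k else 1.
rewrite (eq_bigr (fun k => v (2 + 2 * k)%N)); last first.
  move=> k _; rewrite qminus_qplus /v (_ : (2 + 2 * k)./2 = k + 1)%N; last lia.
  by rewrite (_ : 2 + 2 * k = 2 * (k + 1))%N; last lia.
rewrite (@prod_residue v 2 2) // [X in eqmod _ _ X]big_mkcondr.
by rewrite (eq_bigl (fun k => ~~ odd k)) // => k; lia.
Qed.

Lemma coef_prod_poly (I : Type) (r : seq I) (e : I -> nat) n :
  (\prod_(k <- r) (1 - 'X^(e k)) : {poly int})`_n = (\prod_(k <- r) qminus (e k)) n.
Proof.
suff -> : \prod_(k <- r) qminus (e k) =
    Fps (fun i => (\prod_(k <- r) (1 - 'X^(e k)) : {poly int})`_i) by [].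
elim/big_rec2: _ => [|i f p _ ->]; apply/fpsP => m.
  by rewrite /= coef1.
rewrite -[LHS]/(fps_mul (qminus _) _ m); apply: fps_mul_poly => // j _.
by rewrite coef_fpsD coef_fpsN coef_qX coefB coefXn coef1.
Qed.

Lemma prod_multiples_eqmod j m : (0 < j)%N ->
  eqmod m.+1 (\prod_(1 <= k < m.+1) qminus (j * k)) (sprod (dvdn j) qminus).
Proof.
move=> j0; apply: eqmod_trans; last first.
  by apply: (@eqmod_le _ (j * m).+1); [nia|exact: sprod_eqmod qadic_qminus].
rewrite (big_addn 0 m.+1 1) subn1.
rewrite (eq_bigr (fun k => qminus (j + j * k)%N)); last first.
  by move=> k _; rewrite addn1 mulnS.
rewrite prod_residue ?j0 ?leqnn //.
by rewrite (eq_bigl (dvdn j)) // => k; rewrite modnn.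
Qed.

(** Turns relations between the [f_j] into relations between sets of integers. *)
Lemma qprod_sprod j : (0 < j)%N -> qprod j = sprod (dvdn j) qminus.
Proof.
move=> j0; apply/fpsP => n; rewrite [LHS]/= /qpartial coef_prod_poly.
exact: prod_multiples_eqmod.
Qed.

(** * The q-binomial theorem and the limit of its coefficients *)

Fixpoint gauss_bin (R : comNzRingType) (p : R) (n k : nat) : R :=
  match n, k with
  | _, 0%N => 1
  | 0%N, _.+1 => 0
  | n'.+1, k'.+1 => gauss_bin p n' k'.+1 + p ^+ (n' - k') * gauss_bin p n' k'
  end.

Lemma gauss_bin0 (R : comNzRingType) (p : R) n : gauss_bin p n 0 = 1.
Proof. by case: n. Qed.

Lemma gauss_bin_small (R : comNzRingType) (p : R) n k :
  (n < k)%N -> gauss_bin p n k = 0.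
Proof.
elim: n k => [|n IHn] [|k] //= nk.
by rewrite !IHn ?mulr0 ?addr0 // ltnW.
Qed.

(** Multiplying by the last factor [y + x * p ^+ n] gives the two terms of the q-Pascal rule that
    defines [gauss_bin]. The second variable [y] later avoids negative powers of [q]. *)
Lemma gauss_binomial (R : comNzRingType) (p x y : R) n :
  \prod_(0 <= k < n) (y + x * p ^+ k) =
  \sum_(j < n.+1) gauss_bin p n j * p ^+ 'C(j, 2) * x ^+ j * y ^+ (n - j).
Proof.
elim: n => [|n IHn]; first by rewrite big_geq // big_ord1 /= !mulr1.
rewrite big_nat_recr //= IHn mulrDr [RHS]big_ord_recl /=.
under [in RHS]eq_bigr => k _ do rewrite /= mulrDl mulrDl mulrDl.
rewrite big_split /= addrA; congr (_ + _).
  rewrite big_ord_recl [in RHS]big_ord_recr /= mulrDl big_distrl /=.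
  rewrite (@gauss_bin_small _ p n n.+1) // !mul0r addr0 gauss_bin0 !subn0 -mulrA -exprSr.
  by congr (_ + _); apply: eq_bigr => k _; rewrite -mulrA -exprSr -subSn.
rewrite big_distrl /=; apply: eq_bigr => k _.
rewrite /bump /= add1n binS bin1 subSS exprD exprS.
have -> : p ^+ n = p ^+ (n - k) * p ^+ k by rewrite -exprD subnK // -ltnS.
ring.
Qed.

Definition qfact (R : comNzRingType) (p : R) n := \prod_(1 <= k < n.+1) (1 - p ^+ k).

Lemma qfactS (R : comNzRingType) (p : R) n :
  qfact p n.+1 = qfact p n * (1 - p ^+ n.+1).
Proof. by rewrite /qfact big_nat_recr. Qed.

(** The factorial formula without division; the induction rests on [1 - p^(n+1) = (1 - p^(n-k)) +
    p^(n-k) (1 - p^(k+1))]. *)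
Lemma gauss_bin_fact (R : comNzRingType) (p : R) n k : (k <= n)%N ->
  gauss_bin p n k * qfact p k * qfact p (n - k) = qfact p n.
Proof.
have q0 : qfact p 0 = 1 by rewrite /qfact big_geq.
elim: n k => [|n IHn] [|k] //= kn; rewrite ?q0 ?mul1r ?mulr1 //.
rewrite subSS qfactS mulrDl mulrDl [RHS]qfactS.
have -> : p ^+ (n - k) * gauss_bin p n k * (qfact p k * (1 - p ^+ k.+1)) *
    qfact p (n - k) = qfact p n * (p ^+ (n - k) * (1 - p ^+ k.+1)).
  by rewrite -(IHn k) //; ring.
have [nk|nk] := leqP n k.
  have -> : k = n by lia.
  by rewrite gauss_bin_small // !mul0r add0r subnn mul1r.
have := IHn k.+1 nk; rewrite qfactS => <-.
have -> : p ^+ n.+1 = p ^+ (n - k) * p ^+ k.+1.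
  by rewrite -exprD; congr (_ ^+ _); lia.
have -> : (n - k = (n - k.+1).+1)%N by lia.
rewrite qfactS; ring.
Qed.

(** All three q-factorials in [gauss_bin_fact] agree with the infinite product to this order, so the
    coefficient tends to the inverse of that product. *)
Lemma gauss_bin_eqmod m n k : (0 < m)%N -> (k <= n)%N ->
  eqmod (minn k (n - k)).+1 (sprod (dvdn m) qminus * gauss_bin (q ^+ m) n k) 1.
Proof.
move=> m0 kn; set F := sprod _ _; set M := minn _ _.
have qF i : (M <= i)%N -> eqmod M.+1 (qfact (q ^+ m) i) F.
  move=> Mi; apply: (@eqmod_le _ i.+1) => //.
  apply: eqmod_trans _ (prod_multiples_eqmod m0).
  by rewrite /qfact; under eq_bigr => j _ do rewrite -exprM -/(qminus _).
have FV : F * sprod (dvdn m) qgeom = 1 by exact: sprod_qminus_qgeom.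
set G := sprod (dvdn m) qgeom in FV.
have E := gauss_bin_fact (q ^+ m) kn.
(* As [G] is the inverse of [F], it suffices to compare [gauss_bin * F * F] with [F]. *)
have -> : 1 = F * G :> fps int by [].
have -> : F * gauss_bin (q ^+ m) n k = gauss_bin (q ^+ m) n k * F * F * G.
  by rewrite -[_ * F * G]mulrA FV mulr1 mulrC.
apply: eqmodM => //.
apply: eqmod_trans _ (qF n _); last by rewrite /M; lia.
rewrite -E; apply: eqmodM; first apply: eqmodM => //.
  by apply/eqmod_sym/qF; rewrite /M; lia.
by apply/eqmod_sym/qF; rewrite /M; lia.
Qed.

(** * Theta functions and the Jacobi triple product *)

(* The theta function [f(q^a, q^b)] with [a + b = 2h] is the sum over [j : int]
   of [q^(h j (j - 1) + a j)]. *)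
Definition texp (h a : nat) (j : int) : nat :=
  absz (h%:Z * (j * j - j) + a%:Z * j).

(** Shows that [absz] in [texp] changes nothing, and that only [j] with [|j| <= n] contribute to
    [q^n], which justifies the window in [theta]. *)
Lemma texp_lower (h a : nat) (j : int) : (0 < a < h.*2)%N ->
  `|j| <= h%:Z * (j * j - j) + a%:Z * j.
Proof.
move=> ah; have [j0|j0] := leP 0 j.
  have : 0 <= h%:Z * (j * j - j) by apply: mulr_ge0 => //; nia.
  have : 0 <= (a%:Z - 1) * j by apply: mulr_ge0 => //; lia.
  by rewrite mulrBl mul1r; lia.
have : 0 <= h%:Z * (j * j + j) by apply: mulr_ge0 => //; nia.
have : 0 <= (2 * h%:Z - a%:Z - 1) * (- j) by apply: mulr_ge0; lia.
rewrite !mulrDr !mulrDl; lia.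
Qed.

Lemma texpE h a j : (0 < a < h.*2)%N ->
  (texp h a j)%:Z = h%:Z * (j * j - j) + a%:Z * j.
Proof.
move=> ah; rewrite /texp gez0_abs //.
exact: le_trans (normr_ge0 j) (texp_lower j ah).
Qed.

Lemma texp_ge h a j : (0 < a < h.*2)%N -> (`|j| <= texp h a j)%N.
Proof. by move=> ah; rewrite -lez_nat texpE // abszE texp_lower. Qed.

Definition window (N : nat) : seq int := [seq i%:Z - N%:Z | i <- iota 0 N.*2.+1].

Lemma mem_window N j : (j \in window N) = (`|j| <= N)%N.
Proof.
apply/mapP/idP => [[i] | jN]; first by rewrite mem_iota => iN ->; lia.
by exists (absz (j + N%:Z)); rewrite ?mem_iota; lia.
Qed.

Lemma uniq_window N : uniq (window N).
Proof. by rewrite map_inj_uniq ?iota_uniq // => i j; lia. Qed.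

Lemma coef_sum_qX (I : Type) (r : seq I) (e : I -> nat) n :
  (\sum_(x <- r) q ^+ e x) n = (count (fun x => e x == n) r)%:R.
Proof.
rewrite coef_fps_sum; elim: r => [|x r IHr]; first by rewrite big_nil.
by rewrite big_cons IHr coef_qX /= natrD eq_sym.
Qed.

Definition theta (h a : nat) : fps int :=
  Fps (fun n => (count (fun j => texp h a j == n) (window n))%:R).

Lemma theta_eqmod h a N : (0 < a < h.*2)%N ->
  eqmod N.+1 (\sum_(j <- window N) q ^+ texp h a j) (theta h a).
Proof.
move=> ah n; rewrite ltnS => nN; rewrite coef_sum_qX -[RHS]/(_%:R) -!size_filter.
congr (_ *+ _).
apply/perm_size/uniq_perm; rewrite ?filter_uniq ?uniq_window //.
move=> j; rewrite !mem_filter !mem_window; case: eqP => //= tn.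
by have := texp_ge j ah; rewrite tn; lia.
Qed.

(* The q-binomial theorem for [p = q^(2h)], [x = q^a], [y = q^(2hN)], with 2N
   factors, divided by the power [q^E] that occurs on both sides. *)
Lemma finite_triple_product h a N : (0 < a < h.*2)%N ->
  (\prod_(0 <= k < N) qplus (a + h.*2 * k)) *
  (\prod_(0 <= k < N) qplus (h.*2 - a + h.*2 * k)) =
  \sum_(j < N.*2.+1) gauss_bin (q ^+ h.*2) N.*2 j * q ^+ texp h a (j%:Z - N%:Z).
Proof.
move=> ah.
(* From the first [N] factors [y + x * p ^+ k] the term [x * p ^+ k] is taken out, from the last [N]
   the term [y]; [E] is the total exponent. *)
pose E := (\sum_(0 <= k < N) (a + h.*2 * k) + h.*2 * N * N)%N.
have E0 : (\sum_(0 <= k < N) (a + h.*2 * k) + h * N = a * N + h * N * N)%N.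
  elim: (N) => [|n IHn]; first by rewrite big_geq // !muln0.
  by rewrite big_nat_recr //=; nia.
have bin2D j : (('C(j, 2)).*2 + j = j * j)%N.
  by elim: j => // j IHj; rewrite binS bin1; lia.
apply: (@mulqXI E); rewrite /=.
have := gauss_binomial (q ^+ h.*2) (q ^+ a) (q ^+ (h.*2 * N)) N.*2.
rewrite (big_cat_nat (n := N)) //=; last lia.
rewrite (big_addn 0 N.*2 N) (_ : N.*2 - N = N)%N; last lia.
set P1 := \prod_(0 <= i < N) _; set P2 := \prod_(0 <= i < N) _ => P12.
have -> : q ^+ E * (\prod_(0 <= k < N) qplus (a + h.*2 * k) *
    \prod_(0 <= k < N) qplus (h.*2 - a + h.*2 * k)) = P1 * P2.
  have -> : P1 = q ^+ (\sum_(0 <= k < N) (a + h.*2 * k)) *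
      \prod_(0 <= k < N) qplus (h.*2 - a + h.*2 * k).
    rewrite [X in _ * X]big_nat_rev /= -prodrXr -big_split /= /P1 !big_nat.
    apply: eq_bigr => k /andP[_ kN]; rewrite /qplus mulrDr mulr1 addrC.
    by rewrite -exprM -!exprD; congr (_ + _ ^+ _); nia.
  have -> : P2 = q ^+ (h.*2 * N * N) * \prod_(0 <= k < N) qplus (a + h.*2 * k).
    have -> : q ^+ (h.*2 * N * N) = \prod_(0 <= k < N) q ^+ (h.*2 * N).
      by rewrite big_const_nat subn0 iter_mulr_1 exprM.
    rewrite -big_split /= /P2; apply: eq_bigr => k _.
    rewrite /qplus mulrDr mulr1; congr (_ + _).
    by rewrite -exprM -!exprD; congr (_ ^+ _); nia.
  rewrite exprD; ring.
rewrite P12 big_distrr /=; apply: eq_bigr => j _.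
rewrite mulrCA -!mulrA; congr (_ * _).
rewrite -!exprM -!exprD; congr (_ ^+ _).
have jN := ltn_ord j; have bj := bin2D j.
apply/eqP; rewrite -eqz_nat !PoszD texpE // /E; apply/eqP.
move: E0 bj; set S := (\sum_(0 <= k < N) _)%N; set C := 'C(j, 2) => E0 bj.
have [r rE rN] : exists2 r, (N.*2 - j = r)%N & (r + j = N.*2)%N.
  by exists (N.*2 - j)%N; lia.
(* With these nonlinear products supplied, equality of the exponents is linear in the monomials. *)
have hC : (h * (C.*2 + j) = h * (j * j))%N by rewrite bj.
have hr : (h * N * (r + j) = h * N * N.*2)%N by rewrite rN.
rewrite rE; move: hC hr E0; clear; lia.
Qed.

Lemma jacobi_triple_product h a : (0 < a < h.*2)%N ->
  theta h a = sprod (dvdn h.*2) qminus *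
    (sprod (fun k => k == a %[mod h.*2]) qplus *
     sprod (fun k => k == h.*2 - a %[mod h.*2])%N qplus).
Proof.
move=> ah; apply: eqmod_all_eq => N; apply: (@eqmod_le _ N.+1) => //.
apply: eqmod_trans (eqmod_sym (theta_eqmod ah)) _.
have half b : (0 < b <= h.*2)%N -> eqmod N.+1 (\prod_(0 <= k < N) qplus (b + h.*2 * k))
    (sprod (fun k => k == b %[mod h.*2]) qplus).
  move=> bh; rewrite prod_residue //.
  by apply: (@eqmod_le _ (h.*2 * N).+1); [nia|exact: sprod_eqmod qadic_qplus].
apply: eqmod_trans _ (eqmodM (eqmod_refl _)
  (eqmodM (half a _) (half (h.*2 - a)%N _))); try lia.
rewrite finite_triple_product // big_distrr /= /window big_map.
rewrite -[iota _ _]/(index_iota 0 N.*2.+1) big_mkord.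
apply: eqmod_sum => j; rewrite mulrA mulrC -[X in eqmod _ X _]mulr1.
(* The coefficient is correct only to order [N - |j - N|], but the power of [q] beside it is at
   least [|j - N|], so errors start beyond [q^N]. *)
have jN := ltn_ord j; have tj := texp_ge (j%:Z - N%:Z) ah.
apply: eqmod_le _ (eqmod_qX (eqmod_sym (gauss_bin_eqmod _ _))); lia.
Qed.

(** * Products of two theta functions *)

Definition square (N : nat) : seq (int * int) :=
  [seq (i, j) | i <- window N, j <- window N].

Lemma mem_square (N : nat) (p : int * int) :
  (p \in square N) = (`|p.1| <= N)%N && (`|p.2| <= N)%N.
Proof.
rewrite -!mem_window; apply/allpairsP/andP => [[p' [? ? ->]] //|[? ?]].
by exists p; split=> //; rewrite -surjective_pairing.
Qed.

Lemma uniq_square N : uniq (square N).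
Proof. by rewrite allpairs_uniq ?uniq_window // => -[i j] [k l] _ _. Qed.

Definition texp2 h a b (p : int * int) := (texp h a p.1 + texp h b p.2)%N.

Definition sols h a b n := [seq p <- square n | texp2 h a b p == n].

Lemma mem_sols (h a b n : nat) (p : int * int) : (0 < a < h.*2)%N -> (0 < b < h.*2)%N ->
  (p \in sols h a b n) = (texp2 h a b p == n).
Proof.
move=> ah bh; rewrite mem_filter mem_square; case: eqP => //=; rewrite /texp2 => pn.
have := texp_ge p.1 ah; have := texp_ge p.2 bh; rewrite -pn => p2 p1.
by apply/andP; split; lia.
Qed.

Lemma uniq_sols h a b n : uniq (sols h a b n).
Proof. exact/filter_uniq/uniq_square. Qed.

(** Reduces identities between such products to bijections between finite solution sets. *)
Lemma coef_thetaM h a b n : (0 < a < h.*2)%N -> (0 < b < h.*2)%N ->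
  (theta h a * theta h b) n = (size (sols h a b n))%:R.
Proof.
move=> ah bh.
rewrite -(eqmodM (@theta_eqmod h a n ah) (@theta_eqmod h b n bh) (ltnSn n)).
rewrite big_distrlr /=.
rewrite -(big_allpairs (F := fun p => q ^+ texp h a p.1 * q ^+ texp h b p.2)).
under eq_bigr => p _ do rewrite -exprD.
by rewrite coef_sum_qX size_filter.
Qed.

Lemma theta_addition :
  theta 5 1 * theta 5 3 = theta 10 4 * theta 10 8 + q * (theta 10 6 * theta 10 2).
Proof.
apply/fpsP => n.
(* [phi] reaches the pairs of even sum, [psi] those of odd sum. *)
pose phi (p : int * int) : int * int := (p.1 + p.2, p.1 - p.2).
pose psi (p : int * int) : int * int := (1 - p.1 - p.2, p.2 - p.1).
(* Since [(u + v)^2 + (u - v)^2 = 2u^2 + 2v^2], both substitutions diagonalise the form and double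
   [h]; [psi] leaves an extra 1, the source of the factor [q]. *)
have E0 p : texp2 5 1 3 (phi p) = texp2 10 4 8 p.
  by apply/eqP; rewrite -eqz_nat !PoszD !texpE //=; apply/eqP; lia.
have E1 p : texp2 5 1 3 (psi p) = (texp2 10 6 2 p + 1)%N.
  by apply/eqP; rewrite -eqz_nat !PoszD !texpE //=; apply/eqP; lia.
rewrite coef_fpsD coef_thetaM // coef_thetaM //.
have -> : (q * (theta 10 6 * theta 10 2)) n =
    (if n is n'.+1 then size (sols 10 6 2 n') else 0)%:R.
  by case: n => [|n]; rewrite ?coef_qM0 // coef_qMS coef_thetaM.
rewrite -natrD; congr (_%:R).
rewrite -(size_map phi (sols 10 4 8 n)) (_ : (if _ is _.+1 then _ else _) =
   size (map psi (if n is n'.+1 then sols 10 6 2 n' else [::]))); last first.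
  by case: n => // n; rewrite size_map.
rewrite -size_cat; apply/perm_size/uniq_perm.
- exact: uniq_sols.
- have phiI : injective phi by move=> [u v] [u' v'] [? ?]; congr (_, _); lia.
  have psiI : injective psi by move=> [u v] [u' v'] [? ?]; congr (_, _); lia.
  rewrite cat_uniq !map_inj_uniq // uniq_sols; apply/and3P; split=> //.
    (* The coordinate sum is [2u'] on images of [phi] and [1 - 2u] on images of [psi]. *)
    apply/hasPn => _ /mapP[[u v] _ ->]; apply/negP => /mapP[[u' v'] _].
    by rewrite /phi /psi => -[]; lia.
  by case: n => // n; apply: uniq_sols.
move=> [i j]; rewrite mem_sols // mem_cat.
apply/idP/orP => [/eqP ijn|[/mapP[p]|/mapP[p pn ->]]].
- have [ij_even|ij_odd] := boolP (2 %| (i + j))%Z.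
  + left; pose p : int * int := ((i + j) %/ 2, (i - j) %/ 2)%Z.
    have ijE : (i, j) = phi p by congr (_, _); rewrite /=; lia.
    apply/mapP; exists p => //.
    by rewrite mem_sols // -E0 -ijE ijn.
  + right; pose p : int * int := ((1 - i - j) %/ 2, (1 - i + j) %/ 2)%Z.
    have ijE : (i, j) = psi p by congr (_, _); rewrite /=; lia.
    apply/mapP; exists p => //.
    move: ijn; rewrite ijE E1 addn1; case: n => // n [pn].
    by rewrite mem_sols // pn.
- by rewrite mem_sols // => pn ->; rewrite E0.
- by case: n pn => // n; rewrite mem_sols // E1 addn1 => /eqP->.
Qed.


(** * The dissection of the quotient *)

Definition odd_not5 : pred nat := fun k => odd k && ~~ (5 %| k)%N.
Definition mod4_2_not5 : pred nat := fun k => (k %% 4 == 2)%N && ~~ (5 %| k)%N.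
Definition mod4_0_not5 : pred nat := fun k => (4 %| k)%N && ~~ (5 %| k)%N.

(** [theta_addition] in product form: the residues 1, 9, 3, 7 modulo 10 make up the first set, and
    4, 16, 8, 12 and 6, 14, 2, 18 modulo 20 the other two. *)
Lemma theta_product :
  qprod 10 ^+ 2 * sprod odd_not5 qplus =
  qprod 20 ^+ 2 * (sprod mod4_0_not5 qplus + q * sprod mod4_2_not5 qplus).
Proof.
have ok := qadic_qplus.
pose r m a k := (k == a %[mod m])%N.
rewrite (@sprodU4 (r 10 1) (r 10 9) (r 10 3) (r 10 7) odd_not5) //; last first.
  by move=> k _; rewrite /r /odd_not5; lia.
rewrite (@sprodU4 (r 20 4) (r 20 16) (r 20 8) (r 20 12) mod4_0_not5) //; last first.
  by move=> k _; rewrite /r /mod4_0_not5; lia.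
rewrite (@sprodU4 (r 20 6) (r 20 14) (r 20 2) (r 20 18) mod4_2_not5) //; last first.
  by move=> k _; rewrite /r /mod4_2_not5; lia.
have := theta_addition; rewrite !jacobi_triple_product // -!qprod_sprod //.
by rewrite -!/(r _ _) => thetaE; ring: thetaE.
Qed.

Lemma quotient_series_dissection :
  quotient_series =
  sprod mod4_0_not5 qplus * sprod mod4_0_not5 qgeom +
  q * (sprod mod4_2_not5 qplus * sprod mod4_0_not5 qgeom).
Proof.
have ok := qadic_qminus.
pose o := sprod odd_not5 qminus; pose t := sprod mod4_2_not5 qminus.
pose z := sprod mod4_0_not5 qminus.
have f1 : qprod 1 = (qprod 5 * o) * (t * z).
  rewrite !qprod_sprod //; apply: sprodU4 => // k _.
  by rewrite /odd_not5 /mod4_2_not5 /mod4_0_not5; lia.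
have f2 : qprod 2 = qprod 10 * (t * z).
  rewrite !qprod_sprod // -(@sprodU _ _ (fun k => (2 %| k) && ~~ (5 %| k))%N) //.
    by apply: sprodU => // k _; lia.
  by move=> k _; rewrite /mod4_2_not5 /mod4_0_not5; lia.
have f4 : qprod 4 = qprod 20 * z.
  rewrite !qprod_sprod //; apply: sprodU => // k _.
  by rewrite /mod4_0_not5; lia.
have ot : o * sprod odd_not5 qplus = t.
  rewrite sprod_qminus_qplus; apply: eq_sprod => // k.
  by rewrite /odd_not5 /mod4_2_not5; lia.
have zg : z * sprod mod4_0_not5 qgeom = 1 by exact: sprod_qminus_qgeom.
set g := sprod mod4_0_not5 qgeom in zg *.
rewrite /quotient_series; set X := RHS.
(* The denominator is a unit, so the identity may be cross-multiplied. *)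
suff -> : qprod 2 ^+ 2 * qprod 5 = X * (qprod 1 * qprod 4 ^+ 2).
  by rewrite mulrK // unitrM unitrX ?qprod_unit.
have := theta_product; rewrite {}/X f1 f2 f4 => thetaE.
transitivity (qprod 10 ^+ 2 * t * t * z ^+ 2 * qprod 5); first by ring.
(* One [t] is traded for [o] times the odd product of [theta_product]; the other matches the [t] in
   [f_1]. *)
rewrite -{1}ot; ring: thetaE zg.
Qed.

(** * Nonnegativity, support and the signs of the coefficients *)

Definition nonneg (f : fps int) := forall n, 0 <= f n.
Definition supported d (f : fps int) := forall n, ~~ (d %| n)%N -> f n = 0.

Lemma nonnegM f g : nonneg f -> nonneg g -> nonneg (f * g).
Proof. by move=> f0 g0 n; apply: sumr_ge0 => i _; apply: mulr_ge0. Qed.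

Lemma nonneg1 : nonneg 1.
Proof. by case. Qed.

Lemma nonneg_qplus k : nonneg (qplus k).
Proof. by move=> n; rewrite coef_fpsD coef_fps1 coef_qX addr_ge0 ?ler0n. Qed.

Lemma nonneg_qgeom k : nonneg (qgeom k).
Proof. by move=> n; apply: ler0n. Qed.

Lemma nonneg_sprod S u : (forall k, nonneg (u k)) -> nonneg (sprod S u).
Proof.
move=> u0 n; rewrite /=; move: n (index_iota _ _) => n r; move: n.
apply: (big_ind nonneg) => [|f g|k _]; [exact: nonneg1|exact: nonnegM|].
by case: ifP => // _; apply: nonneg1.
Qed.

Lemma supportedM d f g : supported d f -> supported d g -> supported d (f * g).
Proof.
move=> f0 g0 n dn; rewrite coef_fpsM big1 // => i _.
have [di|di] := boolP (d %| i)%N; last by rewrite f0 ?mul0r.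
by rewrite g0 ?mulr0 // dvdn_subl // -ltnS.
Qed.

Lemma supported1 d : supported d 1.
Proof. by move=> [|n]; rewrite ?dvdn0. Qed.

Lemma supported_qplus d k : (d %| k)%N -> supported d (qplus k).
Proof.
move=> dk n dn; rewrite coef_fpsD (supported1 dn) add0r coef_qX.
by case: eqP dn => // ->; rewrite dk.
Qed.

Lemma supported_qgeom d k : (d %| k)%N -> supported d (qgeom k).
Proof.
move=> dk n dn /=; case: (boolP (k %| n)%N) => // kn.
by rewrite (dvdn_trans dk kn) in dn.
Qed.

Lemma supported_sprod d (S : pred nat) u : (forall k, S k -> supported d (u k)) ->
  supported d (sprod S u).
Proof.
move=> u0 n; rewrite /=; move: n (index_iota _ _) => n r; move: n.
apply: (big_ind (supported d)) => [|f g|k _]; [exact: supported1|exact: supportedM|].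
by case: ifP => [/u0//|_]; apply: supported1.
Qed.

Lemma sprod_coef0 S u : sprod S u 0%N = 1.
Proof. by rewrite /= big_geq. Qed.

(** The term [f n * g 0] is one of the nonnegative summands. Positivity thus needs checking on a
    single factor. *)
Lemma coefM_ge f g n : nonneg f -> nonneg g -> g 0%N = 1 -> f n <= (f * g) n.
Proof.
move=> f0 g0 g1; rewrite coef_fpsM big_ord_recr /= subnn g1 mulr1 lerDr.
by apply: sumr_ge0 => i _; apply: mulr_ge0.
Qed.

Lemma qplus_qgeom k : (0 < k)%N -> qplus k * qgeom (2 * k) = qgeom k.
Proof.
move=> k0; rewrite -[RHS]mulr1 -(@qminus_qgeom (2 * k)) ?muln_gt0 //.
rewrite -qminus_qplus -[LHS]mul1r -(qminus_qgeom k0); ring.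
Qed.

Lemma sprod_pred1 (S : pred nat) i u : (0 < i)%N -> S i -> qadic u ->
  sprod S u = u i * sprod (predD1 S i) u.
Proof.
move=> i0 Si u1; rewrite -(sprod1 i0 u1); apply: sprodU => // k _ /=.
by case: eqP => [->|]; rewrite ?Si.
Qed.

Theorem theorem4p3 (n : nat) :
  [/\ (0 < a (4 * n)%N)%R, (0 < a (2 * n + 1)%N)%R & a (4 * n + 2)%N = 0%R].
Proof.
pose g := sprod mod4_0_not5 qgeom.
pose U := sprod mod4_0_not5 qplus * g; pose V := sprod mod4_2_not5 qplus * g.
have gS : supported 4 g.
  by apply: supported_sprod => k /andP[k4 _]; apply: supported_qgeom.
have US : supported 4 U.
  apply: supportedM gS; apply: supported_sprod => k /andP[k4 _].
  exact: supported_qplus.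
have VS : supported 2 V.
  apply: supportedM => [|m m2]; last by apply: gS; lia.
  by apply: supported_sprod => k /andP[k4 _]; apply: supported_qplus; lia.
have pN S : nonneg (sprod S qplus) by apply/nonneg_sprod/nonneg_qplus.
have gN S : nonneg (sprod S qgeom) by apply/nonneg_sprod/nonneg_qgeom.
have gE : g = qgeom 4 * sprod (predD1 mod4_0_not5 4) qgeom.
  exact: sprod_pred1 qadic_qgeom.
have UE : (0 < U (4 * n)%N).
  rewrite /U gE mulrCA; apply: lt_le_trans (coefM_ge _ _ _ _).
  - by rewrite /= dvdn_mulr.
  - exact: nonneg_qgeom.
  - exact: nonnegM.
  - by rewrite coef_fpsM big_ord1 !sprod_coef0.
have VE : (0 < V (2 * n)%N).
  (* The factor [1 + q^2] joins [1 / (1 - q^4)] to give [1 / (1 - q^2)], positive at every even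
     exponent. *)
  rewrite /V gE (sprod_pred1 (i := 2)) //; last exact: qadic_qplus.
  rewrite mulrACA (qplus_qgeom (k := 2)) //; apply: lt_le_trans (coefM_ge _ _ _ _).
  - by rewrite /= dvdn_mulr.
  - exact: nonneg_qgeom.
  - exact: nonnegM.
  - by rewrite coef_fpsM big_ord1 !sprod_coef0.
(* At [4n] and [4n + 2] the term [q * V] vanishes, as [V] is even; [U] vanishes off the multiples of
   4, which leaves [V (2 * n)] at [2n + 1] and nothing at [4n + 2]. *)
rewrite /a quotient_series_dissection -/g -/U -/V !coef_fpsD; split.
- case: n UE {VE} => [|n] UE; first by rewrite muln0 coef_qM0 addr0.
  by rewrite mulnS in UE *; rewrite coef_qMS (VS (3 + 4 * n)%N) ?addr0 //; lia.
- by rewrite US ?add0r; [rewrite addn1 coef_qMS | lia].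
- by rewrite US ?add0r; [rewrite addn2 coef_qMS VS // | ]; lia.
Qed.
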